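(* Let $\Theta_0,\Theta_1\subset\Lambda$. There is a pointwise consistent sequence of tests for $H_0: P\in\Theta_0$ versus $H_1: P\in\Theta_1$ if and only if there are nested subsets $\Theta_{0i}\subseteq\Theta_{0,i+1}$, $i=1,2,\ldots$, with $\Theta_0=\bigcup_{i=1}^\infty\Theta_{0i}$, and nested subsets $\Theta_{1i}\subseteq\Theta_{1,i+1}$, $i=1,2,\ldots$, with $\Theta_1=\bigcup_{i=1}^\infty\Theta_{1i}$, such that, for each $i$, the hypothesis $H_{0i}: P\in\Theta_{0i}$ and the alternative $H_{1i}: P\in\Theta_{1i}$ are distinguishable.
   Context: $\Omega$ is a topological space with Borel $\sigma$-field $\mathfrak{B}$, and $\Lambda$ is the set of all probability measures on $(\Omega,\mathfrak{B})$. One observes i.i.d. random variables $X_1,\ldots,X_n$ with values in $\Omega$ and distribution $P\in\Lambda$. A test $K_n$ is a measurable function of $(X_1,\ldots,X_n)$ with values in $[0,1]$ (the probability of rejecting the hypothesis). For a hypothesis $P\in\Theta_0$ and an alternative $P\in\Theta_1$, put $\alpha_P(K_n)=E_P[K_n]$ for $P\in\Theta_0$, $\beta_P(K_n)=E_P[1-K_n]$ for $P\in\Theta_1$, $\alpha(K_n)=\sup_{P\in\Theta_0}\alpha_P(K_n)$, $\beta(K_n)=\sup_{P\in\Theta_1}\beta_P(K_n)$. A sequence of tests $K_n$ is pointwise consistent if $\lim_{n\to\infty}\alpha_P(K_n)=0$ for every $P\in\Theta_0$ and $\lim_{n\to\infty}\beta_Q(K_n)=0$ for every $Q\in\Theta_1$.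 It is uniformly consistent if $\lim_{n\to\infty}\alpha(K_n)=0$ and $\lim_{n\to\infty}\beta(K_n)=0$. A hypothesis and an alternative are distinguishable if there is a uniformly consistent sequence of tests for them. *)

(* Defs.v *)
From HB Require Import structures.
From mathcomp Require Import all_boot all_order all_algebra.
From mathcomp Require Import all_classical all_reals all_analysis.
Set Implicit Arguments.
Unset Strict Implicit.
Unset Printing Implicit Defensive.
Import Order.TTheory GRing.Theory Num.Theory.
Import numFieldNormedType.Exports.
Local Open Scope classical_set_scope.
Local Open Scope ring_scope.

(* Measurable types are pointed, hence the use of ptopologicalType; this only
   excludes the empty space, which carries no probability measure. *)
Notation borelType Omega := (g_sigma_algebraType (@open Omega)).

Section power_probability.
Context (d : measure_display) (T : measurableType d) (R : realType).

Definition tuple_cons (n : nat) (x : T * n.-tuple T) : n.+1.-tuple T :=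
  [the n.+1.-tuple T of x.1 :: x.2].

Lemma measurable_tuple_cons (n : nat) : measurable_fun setT (@tuple_cons n).
Proof. exact: measurable_cons. Qed.

HB.instance Definition _ (n : nat) :=
  @isMeasurableFun.Build _ _ _ _ (@tuple_cons n) (@measurable_tuple_cons n).

(* The n-fold product P^n, on T^n with the product sigma-algebra: the joint law
   of an i.i.d. sample of size n from P; see [power_probability_rect]. *)
Fixpoint power_probability (P : probability T R) (n : nat) :
    probability (n.-tuple T) R :=
  match n with
  | 0 => @dirac _ (0.-tuple T) [tuple] R
  | m.+1 => distribution (P \x power_probability P m)%E (@tuple_cons m)
  end.

Lemma power_probability_rect (P : probability T R) (n : nat)
    (A : 'I_n -> set T) : (forall i, measurable (A i)) ->
  power_probability P n [set x | forall i, A i (tnth x i)] =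
  (\prod_(i < n) P (A i))%E.
Proof.
elim: n A => [|n IHn] A mA.
  by rewrite big_ord0 /= diracE mem_set // => -[].
rewrite big_ord_recl -(IHn (A \o lift ord0)) => [|i]; last exact: mA.
rewrite /= /distribution /pushforward /= -product_measure1E//.
- congr (_ _); apply/seteqP; split => [[x y]/= Axy|[x y]/= [Ax Ay] i].
    by split=> [|i]; [have := Axy ord0 | have := Axy (lift ord0 i)];
      rewrite ?tnth0 ?tnthS.
  by case: (unliftP ord0 i) => [j|] ->; rewrite ?tnth0 ?tnthS //; exact: Ay.
- rewrite (_ : mkset _ = \bigcap_(i in [set: 'I_n])
    ((fun x : n.-tuple T => tnth x i) @^-1` A (lift ord0 i))); last first.
    by apply/seteqP; split=> x Ax i; [move=> _|]; exact: Ax.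
  apply: fin_bigcap_measurable => // i _; rewrite -[X in measurable X]setTI.
  exact: measurable_tnth.
Qed.

End power_probability.

Section tests.
Context (d : measure_display) (T : measurableType d) (R : realType).
Implicit Types (P Q : probability T R) (Theta : set (probability T R)).

Definition is_test (n : nat) (K : n.-tuple T -> R) : Prop :=
  measurable_fun setT K /\ forall x, 0 <= K x <= 1.

Definition alpha_at (n : nat) (K : n.-tuple T -> R) P : R :=
  fine ('E_(power_probability P n)[K])%E.

Definition beta_at (n : nat) (K : n.-tuple T -> R) P : R :=
  fine ('E_(power_probability P n)[fun x => (1 - K x)%R])%E.

(* For a test these are suprema of subsets of [0, 1]; over an empty hypothesis
   (alternative) the error probability is 0, as [sup set0 = 0] in R. *)
Definition alpha (Theta0 : set (probability T R)) (n : nat)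
  (K : n.-tuple T -> R) : R := sup [set alpha_at K P | P in Theta0].

Definition beta (Theta1 : set (probability T R)) (n : nat)
  (K : n.-tuple T -> R) : R := sup [set beta_at K P | P in Theta1].

Definition pointwise_consistent (Theta0 Theta1 : set (probability T R))
    (K : forall n, n.-tuple T -> R) : Prop :=
  (forall P, Theta0 P -> alpha_at (K n) P @[n --> \oo] --> (0 : R)) /\
  (forall Q, Theta1 Q -> beta_at (K n) Q @[n --> \oo] --> (0 : R)).

Definition uniformly_consistent (Theta0 Theta1 : set (probability T R))
    (K : forall n, n.-tuple T -> R) : Prop :=
  alpha Theta0 (K n) @[n --> \oo] --> (0 : R) /\
  beta Theta1 (K n) @[n --> \oo] --> (0 : R).

Definition distinguishable (Theta0 Theta1 : set (probability T R)) : Prop :=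
  exists K : forall n, n.-tuple T -> R,
    (forall n, is_test (K n)) /\ uniformly_consistent Theta0 Theta1 K.

End tests.

(* Main.v *)
Require Import Defs.
From mathcomp Require Import all_boot all_order all_algebra.
From mathcomp Require Import all_classical all_reals all_analysis.
From mathcomp Require Import measurable_realfun lra.
Import Order.TTheory GRing.Theory Num.Theory.
Import numFieldNormedType.Exports.
Local Open Scope classical_set_scope.
Local Open Scope ring_scope.

(** A pointwise consistent sequence of tests has, for each single law, errors
    that are eventually at most 1/4. Collect in the [i]-th member of the
    exhaustion the laws whose errors are at most 1/4 for every sample size above
    [i]. On the [i]-th members the one test [K i.+1] already separates the
    hypothesis from the alternative with both errors at most 1/4, uniformly.
    Such a separation can be amplified ([distinguishable_quarter]): cut a sample
    of size [n] into [n %/ i.+1] independent blocks of length [i.+1], and combine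
    the values of [K i.+1] on them.

    Instead of a majority vote, which would call for a concentration inequality,
    the combination is multiplicative. The affine function
    [score K = 1/2 + 3/2 * K] of a test has mean at most 7/8 when the mean of [K]
    is at most 1/4, and [score K * score (1 - K) >= 1] pointwise. The product
    [F] of the scores over [k] blocks therefore has mean at most [(7/8) ^ k]
    under the hypothesis, by independence ([integral_prod_blocks]); the product
    [G] of the complementary scores has mean at most [(7/8) ^ k] under the
    alternative, and [F * G >= 1]. The test [min 1 F] is below [F], and its
    complement is below [G], so both of its errors decay geometrically, uniformly
    over the hypothesis and the alternative.

    Conversely, let the [i]-th members be distinguished by tests [K i n]. A
    diagonal argument ([diagonal_cvg0]) gives indices [iota n] that grow to
    infinity so slowly that the uniform errors of [K (iota n) n] on the members
    of index [iota n] tend to 0. A fixed law belongs to the members of all large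
    indices because they are nested, so its error under [K (iota n) n] is
    eventually bounded by the uniform one. *)

(** * Independence of the blocks of an i.i.d. sample *)

Section blocks.
Context {d : measure_display} {T : measurableType d} {R : realType}.
Implicit Types P : probability T R.

(** Positions past the end of the sample are filled with [point]; thus no
    dependent bound is carried around, and consecutive blocks compose
    ([block_block]) without any hypothesis on their lengths. *)
Definition block (s m : nat) {n : nat} (x : n.-tuple T) : m.-tuple T :=
  [tuple nth point x (s + i) | i < m].

Lemma measurable_block s m n :
  measurable_fun [set: n.-tuple T] (@block s m n).
Proof.
apply/measurable_fun_tnthP => i.
case: (ltnP (s + i) n) => [lt_n|le_n].
  rewrite (_ : _ \o _ = fun x : n.-tuple T => tnth x (Ordinal lt_n)).
    exact: measurable_tnth.
  by apply/funext => x; rewrite /= tnth_mktuple (tnth_nth point).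
rewrite (_ : _ \o _ = cst point); first exact: measurable_cst.
by apply/funext => x; rewrite /= tnth_mktuple nth_default// size_tuple.
Qed.

Lemma nth_block s m n (x : n.-tuple T) i :
  (i < m)%N -> nth point (block s m x) i = nth point x (s + i).
Proof. by move=> lt_i; rewrite -(tnth_nth _ _ (Ordinal lt_i)) tnth_mktuple. Qed.

Lemma block_block s m t n (x : (t + n).-tuple T) :
  block s m (block t n x) = block (t + s) m x.
Proof.
apply: eq_from_tnth => i; rewrite !tnth_mktuple -addnA.
case: (ltnP (s + i) n) => [/nth_block->//|le_n].
by rewrite !nth_default// size_tuple ?leq_add2l.
Qed.

Lemma block_id n (x : n.-tuple T) : block 0 n x = x.
Proof. by apply: eq_from_tnth => i; rewrite tnth_mktuple (tnth_nth point). Qed.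

Lemma block_consS s m n (z : T * n.-tuple T) :
  block s.+1 m (tuple_cons z) = block s m z.2.
Proof. by apply: eq_from_tnth => i; rewrite !tnth_mktuple. Qed.

Lemma block_cons0 m n (z : T * n.-tuple T) :
  block 0 m.+1 (tuple_cons z) = tuple_cons (z.1, block 0 m z.2).
Proof.
apply: eq_from_tnth => i; rewrite tnth_mktuple.
by case: (unliftP ord0 i) => [j|] ->; rewrite ?tnth0// tnthS tnth_mktuple.
Qed.

Lemma measurable_tuple_cons_pair n (x : T) :
  measurable_fun [set: n.-tuple T] (fun y => tuple_cons (x, y)).
Proof.
exact: (measurableT_comp (measurable_tuple_cons (n := n)) (measurable_pair1 x)).
Qed.

Lemma integral_power_probabilityS P n (h : n.+1.-tuple T -> \bar R) :
    measurable_fun setT h -> (forall x, 0 <= h x)%E ->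
  (\int[power_probability P n.+1]_z h z =
   \int[P]_x \int[power_probability P n]_y h (tuple_cons (x, y)))%E.
Proof.
move=> mh h0; rewrite /= ge0_integral_distribution//.
rewrite fubini_tonelli1//.
  by apply: measurableT_comp => //; exact: measurable_tuple_cons.
by move=> z; exact: h0.
Qed.

(** The first [a] observations are independent of the last [b]. By induction on
    [a]: conditioning on the first observation turns [f] into a function of
    [a.-1] observations, the integral of [g] being a common factor. *)
Lemma integral_power_probability_mul P a b
    (f : a.-tuple T -> R) (g : b.-tuple T -> R) :
    measurable_fun setT f -> (forall x, 0 <= f x) ->
    measurable_fun setT g -> (forall x, 0 <= g x) ->
  (\int[power_probability P (a + b)]_z (f (block 0 a z) * g (block a b z))%:E =
   \int[power_probability P a]_x (f x)%:E *
   \int[power_probability P b]_y (g y)%:E)%E.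
Proof.
move=> + + mg g0; elim: a f => [|a IHa] f mf f0.
  rewrite [power_probability P 0]/= integral_dirac//; last exact/measurable_EFinP.
  rewrite diracT mul1e -ge0_integralZl//; last 3 first.
  - exact/measurable_EFinP.
  - by move=> x _; rewrite lee_fin.
  - by rewrite lee_fin.
  by apply: eq_integral => x _; rewrite EFinM (tuple0 (block 0 0 x)) block_id.
have mfx x := measurableT_comp mf (measurable_tuple_cons_pair a x).
rewrite [in LHS]addSn integral_power_probabilityS; last 2 first.
- apply/measurable_EFinP; apply: measurable_funM; apply: measurableT_comp => //;
  exact: measurable_block.
- by move=> z; rewrite lee_fin mulr_ge0.
under eq_integral => x _.
  under eq_integral => y _ do rewrite block_cons0 block_consS/=.
  rewrite (IHa (fun y => f (tuple_cons (x, y))) (mfx x))//.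
  over.
rewrite ge0_integralZr//=; last 3 first.
- apply: (@measurable_fun_fubini_tonelli_F _ _ _ _ _ _
    (fun z : T * a.-tuple T => (f (tuple_cons z))%:E)).
  + apply/measurable_EFinP.
    exact: (measurableT_comp mf (measurable_tuple_cons (n := a))).
  + by move=> z; rewrite lee_fin.
- by move=> x _; apply: integral_ge0 => y _; rewrite lee_fin.
- by apply: integral_ge0 => y _; rewrite lee_fin.
rewrite (integral_power_probabilityS P a (fun z => (f z)%:E))//.
exact/measurable_EFinP.
Qed.

(** Splitting off the first block leaves a sample of size [n - m] and a product of
    [k.-1] factors on its blocks; the observations past the last block integrate
    to 1. *)
Lemma integral_prod_blocks P m (f : m.-tuple T -> R) (c : R) :
    measurable_fun setT f -> (forall x, 0 <= f x) ->
    (\int[power_probability P m]_x (f x)%:E = c%:E)%E ->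
  forall k n, (k * m <= n)%N ->
  (\int[power_probability P n]_x (\prod_(j < k) f (block (j * m) m x))%:E =
   (c ^+ k)%:E)%E.
Proof.
move=> mf f0 fc; elim=> [|k IHk] n le_n.
  under eq_integral do rewrite big_ord0.
  by rewrite integral_cst//= probability_setT mule1.
have -> : n = (m + (n - m))%N.
  by rewrite subnKC// (leq_trans _ le_n)// mulSn leq_addr.
have {le_n}: (k * m <= n - m)%N by rewrite leq_subRL ?(leq_trans _ le_n)// mulSn ?leq_addr.
move: (n - m)%N => {}n le_n.
under eq_integral => x _.
  rewrite big_ord_recl/= mul0n.
  under eq_bigr => j _ do rewrite /bump/= add1n mulSn -block_block.
  over.
rewrite (integral_power_probability_mul P m n f
  (fun y => \prod_(j < k) f (block (j * m) m y)))//.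
- by rewrite fc IHk// -EFinM exprS.
- apply: measurable_prod => j _; apply: measurableT_comp => //.
  exact: measurable_block.
- by move=> y; apply: prodr_ge0.
Qed.

End blocks.

(** * Amplification of a test *)

Section error_probabilities.
Context {d : measure_display} {T : measurableType d} {R : realType}.
Implicit Types (P : probability T R) (Theta : set (probability T R)).

Lemma is_testC n (K : n.-tuple T -> R) :
  is_test K -> is_test (fun x => 1 - K x).
Proof.
move=> [mK K01]; split; first exact: measurable_funB.
by move=> x; have := K01 x; lra.
Qed.

Lemma integral_test_le n (K : n.-tuple T -> R) P (f : n.-tuple T -> R) c :
    is_test K -> measurable_fun setT f -> (forall x, K x <= f x) ->
    (\int[power_probability P n]_x (f x)%:E = c%:E)%E ->
  (0 <= \int[power_probability P n]_x (K x)%:E <= c%:E)%E.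
Proof.
move=> [mK K01] mf Kf <-.
have K0 x : 0 <= K x by have /andP[] := K01 x.
apply/andP; split; first by apply: integral_ge0 => x _; rewrite lee_fin.
apply: ge0_le_integral => //.
- by move=> x _; rewrite lee_fin.
- exact/measurable_EFinP.
- exact/measurable_EFinP.
- by move=> x _; rewrite lee_fin.
Qed.

(** As [beta_at K] is [alpha_at] of the complementary test by conversion, this
    bounds both kinds of error. *)
Lemma alpha_at_le n (K : n.-tuple T -> R) P (f : n.-tuple T -> R) c :
    is_test K -> measurable_fun setT f -> (forall x, K x <= f x) ->
    (\int[power_probability P n]_x (f x)%:E = c%:E)%E ->
  0 <= alpha_at K P <= c.
Proof.
move=> tK mf Kf fc; have /andP[I0 Ic] := integral_test_le n K P f c tK mf Kf fc.
have Ifin : (\int[power_probability P n]_x (K x)%:E)%E \is a fin_num.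
  by rewrite ge0_fin_numE// (le_lt_trans Ic)// ltry.
by rewrite /alpha_at unlock -!lee_fin fineK// I0.
Qed.

Lemma alpha_at01 n (K : n.-tuple T -> R) P : is_test K -> 0 <= alpha_at K P <= 1.
Proof.
move=> tK; apply: (alpha_at_le n K P (cst 1)) => //.
  by move=> x; have /andP[] := tK.2 x.
by rewrite /= integral_cst//= probability_setT mule1.
Qed.

Lemma integral_test n (K : n.-tuple T -> R) P : is_test K ->
  (\int[power_probability P n]_x (K x)%:E = (alpha_at K P)%:E)%E.
Proof.
move=> tK; rewrite /alpha_at unlock fineK//.
have /andP[I0 I1] : (0 <= \int[power_probability P n]_x (K x)%:E <= 1%:E)%E.
  apply: (integral_test_le n K P (cst 1)) => //.
    by move=> x; have /andP[] := tK.2 x.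
  by rewrite /= integral_cst//= probability_setT mule1.
by rewrite ge0_fin_numE// (le_lt_trans I1)// ltry.
Qed.

(** The slope and the intercept are subject to two requirements: a mean of [K] at
    most 1/4 must give a mean below 1 (here [1/2 + 3/8 = 7/8]), and the products
    in [score_mul_ge1] must not be below 1 (here they equal 1 when [K] is 0 or
    1). *)
Definition score {n} (K : n.-tuple T -> R) (x : n.-tuple T) : R :=
  2^-1 + 3 / 2 * K x.

Lemma measurable_score n (K : n.-tuple T -> R) :
  is_test K -> measurable_fun setT (score K).
Proof.
move=> [mK _]; apply: measurable_funD => //.
exact: measurable_funM.
Qed.

Lemma score_ge0 n (K : n.-tuple T -> R) x : is_test K -> 0 <= score K x.
Proof. by move=> [_ /(_ x)]; rewrite /score; lra. Qed.

(** The product is [1 + 9/4 * K x * (1 - K x)]. *)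
Lemma score_mul_ge1 n (K : n.-tuple T -> R) x : is_test K ->
  1 <= score K x * score (fun x => 1 - K x) x.
Proof. by move=> [_ /(_ x)]; rewrite /score; nra. Qed.

Lemma integral_score n (K : n.-tuple T -> R) P : is_test K ->
  (\int[power_probability P n]_x (score K x)%:E =
   (2^-1 + 3 / 2 * alpha_at K P)%:E)%E.
Proof.
move=> tK; have [mK K01] := tK.
have K0 x : 0 <= K x by have /andP[] := K01 x.
rewrite /score; under eq_integral => x _ do rewrite EFinD EFinM.
have c0 : 0 <= 3 / 2 :> R by lra.
have h0 : 0 <= 2^-1 :> R by lra.
have mK' := (iffRL (measurable_EFinP setT K)) mK.
rewrite ge0_integralD//; last 2 first.
- by move=> x _; rewrite mule_ge0// lee_fin.
- exact: emeasurable_funM.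
by rewrite ge0_integralZl// ?integral_cst//= ?probability_setT ?mule1
   ?integral_test// => x _; rewrite lee_fin.
Qed.

Definition amplify {m} (K : m.-tuple T -> R) k n (x : n.-tuple T) : R :=
  Num.min 1 (\prod_(j < k) score K (block (j * m) m x)).

Lemma measurable_prod_score m (K : m.-tuple T -> R) k n : is_test K ->
  measurable_fun [set: n.-tuple T]
    (fun x => \prod_(j < k) score K (block (j * m) m x)).
Proof.
move=> tK; apply: measurable_prod => j _.
by apply: measurableT_comp; [exact: measurable_score|exact: measurable_block].
Qed.

Lemma amplify_test m (K : m.-tuple T -> R) k n :
  is_test K -> is_test (amplify K k n).
Proof.
move=> tK; split=> [|x].
  by apply: measurable_minr => //; exact: measurable_prod_score.
rewrite /amplify ge_min lexx/= le_min ler01 prodr_ge0// => j _.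
exact: score_ge0.
Qed.

Lemma alpha_at_amplify m (K : m.-tuple T -> R) P k n :
    is_test K -> (k * m <= n)%N ->
  alpha_at (amplify K k n) P <= (2^-1 + 3 / 2 * alpha_at K P) ^+ k.
Proof.
move=> tK le_n; suff /andP[] : 0 <= alpha_at (amplify K k n) P <=
  (2^-1 + 3 / 2 * alpha_at K P) ^+ k by [].
apply: (alpha_at_le _ _ _
    (fun x => \prod_(j < k) score K (block (j * m) m x))).
- exact: amplify_test.
- exact: measurable_prod_score.
- by move=> x; rewrite /amplify ge_min lexx orbT.
- apply: integral_prod_blocks => //; first exact: measurable_score.
  + by move=> x; exact: score_ge0.
  + exact: integral_score.
Qed.

(** The product [F] of the scores and the product [G] of the complementary scores
    satisfy [1 <= F * G], hence [1 - min 1 F <= G]: either [F >= 1] and the left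
    side is 0, or [F < 1] forces [G >= 1]. *)
Lemma beta_at_amplify m (K : m.-tuple T -> R) P k n :
    is_test K -> (k * m <= n)%N ->
  beta_at (amplify K k n) P <= (2^-1 + 3 / 2 * beta_at K P) ^+ k.
Proof.
move=> tK le_n; have tKC := is_testC m K tK.
suff /andP[] : 0 <= beta_at (amplify K k n) P <=
  (2^-1 + 3 / 2 * beta_at K P) ^+ k by [].
apply: (alpha_at_le _ _ _
  (fun x => \prod_(j < k) score (fun x => 1 - K x) (block (j * m) m x))).
- exact/is_testC/amplify_test.
- exact: measurable_prod_score.
- move=> x; rewrite /amplify.
  set F := \prod_(j < k) _; set G := \prod_(j < k) _.
  have F0 : 0 <= F by apply: prodr_ge0 => j _; exact: score_ge0.
  have G0 : 0 <= G by apply: prodr_ge0 => j _; exact: score_ge0.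
  have FG1 : 1 <= F * G.
    by rewrite -big_split; elim/big_ind: _ => //= [u v|j _];
      [exact: mulr_ege1|exact: score_mul_ge1].
  by case: (leP 1 F) => F1; nra.
- apply: integral_prod_blocks => //; first exact: measurable_score.
  + by move=> x; exact: score_ge0.
  + exact: integral_score.
Qed.

Lemma alpha_at_le_alpha Theta n (K : n.-tuple T -> R) P :
  is_test K -> Theta P -> alpha_at K P <= alpha Theta K.
Proof.
move=> tK ThetaP; apply: ub_le_sup; last by exists P.
by exists 1 => _ [Q _ <-]; have /andP[] := alpha_at01 n K Q tK.
Qed.

Lemma alpha_ge0 Theta n (K : n.-tuple T -> R) : is_test K -> 0 <= alpha Theta K.
Proof.
move=> tK; have [->|/set0P[P ThetaP]] := eqVneq Theta set0.
  by rewrite /alpha image_set0 sup0.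
apply: le_trans (alpha_at_le_alpha Theta n K P tK ThetaP).
by have /andP[] := alpha_at01 n K P tK.
Qed.

Lemma alpha_le Theta n (K : n.-tuple T -> R) c :
  0 <= c -> (forall P, Theta P -> alpha_at K P <= c) -> alpha Theta K <= c.
Proof.
move=> c0 Kc; have [->|/set0P[P ThetaP]] := eqVneq Theta set0.
  by rewrite /alpha image_set0 sup0.
apply: ge_sup; first by exists (alpha_at K P), P.
by move=> _ [Q ThetaQ <-]; exact: Kc.
Qed.

Lemma beta_at_le_beta Theta n (K : n.-tuple T -> R) P :
  is_test K -> Theta P -> beta_at K P <= beta Theta K.
Proof. by move=> /is_testC; exact: alpha_at_le_alpha. Qed.

Lemma beta_at_ge0 n (K : n.-tuple T -> R) P : is_test K -> 0 <= beta_at K P.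
Proof. by move=> /is_testC tK; have /andP[] := alpha_at01 n _ P tK. Qed.

Lemma beta_ge0 Theta n (K : n.-tuple T -> R) : is_test K -> 0 <= beta Theta K.
Proof. by move=> /is_testC; exact: alpha_ge0. Qed.

(** One test with both errors at most 1/4 on a fixed sample size suffices: applied
    to the [n %/ m.+1] disjoint blocks of a sample of size [n], it gives errors at
    most [(7/8) ^ (n %/ m.+1)]. *)
Lemma distinguishable_quarter Theta0 Theta1 m (K : m.+1.-tuple T -> R) :
    is_test K ->
    (forall P, Theta0 P -> alpha_at K P <= 4^-1) ->
    (forall Q, Theta1 Q -> beta_at K Q <= 4^-1) ->
  distinguishable Theta0 Theta1.
Proof.
move=> tK K0 K1.
pose L n := amplify K (n %/ m.+1) n.
have tL n : is_test (L n) by exact: amplify_test.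
have rate : (7 / 8 : R) ^+ (n %/ m.+1) @[n --> \oo] --> (0 : R).
  apply: (@cvg_comp _ _ _ (fun n => (n %/ m.+1)%N) (fun k => (7 / 8 : R) ^+ k)
    \oo \oo).
    apply/cvgnyPge => A; near=> n.
    by rewrite leq_divRL//; near: n; exact: nbhs_infty_ge.
  by apply: cvg_expr; rewrite ger0_norm; lra.
have rate0 n : 0 <= (7 / 8 : R) ^+ (n %/ m.+1) by apply: exprn_ge0; lra.
have bound (a : R) n : 0 <= a <= 4^-1 ->
    (2^-1 + 3 / 2 * a) ^+ (n %/ m.+1) <= (7 / 8) ^+ (n %/ m.+1).
  by move=> a14; apply: lerXn2r; rewrite ?nnegrE; lra.
exists L; split=> //; split.
- apply: (squeeze_cvgr _ (cvg_cst _) rate); apply: nearW => n.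
  rewrite alpha_ge0//=; apply: alpha_le => // P Theta0P.
  apply: le_trans (alpha_at_amplify _ _ _ _ _ tK (leq_trunc_div _ _)) _.
  by apply: bound; rewrite K0// andbT; have /andP[] := alpha_at01 _ K P tK.
- apply: (squeeze_cvgr _ (cvg_cst _) rate); apply: nearW => n.
  rewrite beta_ge0//=; apply: alpha_le => // P Theta1P.
  apply: le_trans (beta_at_amplify _ _ _ _ _ tK (leq_trunc_div _ _)) _.
  by apply: bound; rewrite K1// beta_at_ge0.
Unshelve. all: by end_near. Qed.

End error_probabilities.

(** * Exhaustions and diagonal sequences *)

(** These are the members of the exhaustion: from some sample size on, the error
    of a pointwise consistent test is at most any prescribed positive level. *)
Lemma bigcup_eventually_le (R : realType) (U : Type) (Theta : set U)
    (err : nat -> U -> R) (e : R) :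
    0 < e -> (forall n P, 0 <= err n P) ->
    (forall P, Theta P -> err n P @[n --> \oo] --> (0 : R)) ->
  Theta = \bigcup_i [set P | Theta P /\ forall n, (i < n)%N -> err n P <= e].
Proof.
move=> e0 err0 errcvg; apply/seteqP; split=> [P ThetaP|P [i _ []]//].
have /cvgr0Pnorm_le/(_ e e0)[i _ iP] := errcvg P ThetaP.
exists i => //; split=> // n lt_n.
by rewrite -[leLHS]ger0_norm// iP//= ltnW.
Qed.

(** Let [N i] be a rank from which [u i] is at most [1 / i.+1]; then [iota n] is
    the largest [i <= n] with [N i <= n]. The bound [i <= n] makes this a finite
    maximum, and it does not prevent [iota n] from growing. *)
Lemma diagonal_cvg0 (R : realType) (u : nat -> nat -> R) :
    (forall i, u i n @[n --> \oo] --> (0 : R)) ->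
  exists iota : nat -> nat,
    (iota n @[n --> \oo] --> \oo) /\ (u (iota n) n @[n --> \oo] --> (0 : R)).
Proof.
move=> u0.
have /choice[N NP] : forall i, exists N, forall n, (N <= n)%N ->
    `|u i n| <= i.+1%:R^-1.
  move=> i; have /cvgr0Pnorm_le/(_ i.+1%:R^-1) := u0 i.
  by rewrite invr_gt0 ltr0Sn => /(_ isT)[N _ NP]; exists N => n /NP.
(* The default index [ord0] satisfies the condition only when [N 0 <= n], hence
   the premise of [iotaP]. *)
pose iota n : nat := [arg max_(i > (ord0 : 'I_n.+1) | (N i <= n)%N) (i : nat)].
have iotaP n : (N 0 <= n)%N -> (N (iota n) <= n)%N /\
    forall j, (j <= n)%N -> (N j <= n)%N -> (j <= iota n)%N.
  rewrite /iota => N0; case: arg_maxnP => // i Ni imax; split=> // j jn Nj.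
  exact: (imax (Ordinal (jn : (j < n.+1)%N))).
have iotay : iota n @[n --> \oo] --> \oo.
  apply/cvgnyPge => A; near=> n.
  have [|_] := iotaP n; first by near: n; exact: nbhs_infty_ge.
  by apply; near: n; exact: nbhs_infty_ge.
exists iota; split=> //; apply/cvgr0Pnorm_le => e e0; near=> n.
have [|Nn _] := iotaP n; first by near: n; exact: nbhs_infty_ge.
apply: le_trans (NP _ _ Nn) _; rewrite -[leRHS]invrK lef_pV2 ?posrE ?invr_gt0//.
near: n; have /cvgnyPge/(_ (Num.truncn e^-1)) := iotay.
apply: filterS => n le_n.
by rewrite ltW// (lt_le_trans (truncnS_gt _))// ler_nat.
Unshelve. all: by end_near. Qed.

Lemma bigcup_nested_near (T : Type) (A : nat -> set T) (x : T)
    (iota : nat -> nat) :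
    (forall i, A i `<=` A i.+1) -> (\bigcup_i A i) x ->
    iota n @[n --> \oo] --> \oo ->
  \forall n \near \oo, A (iota n) x.
Proof.
move=> AS [j _ Ajx] /cvgnyPge/(_ j); apply: filterS => n le_j.
rewrite -(subnKC le_j); elim: (_ - _)%N => [|k]; first by rewrite addn0.
by rewrite addnS; exact: AS.
Qed.

Theorem theorem3p2 (R : realType) (Omega : ptopologicalType)
    (Theta0 Theta1 : set (probability (borelType Omega) R)) :
  (exists K : forall n : nat, n.-tuple (borelType Omega) -> R,
     (forall n : nat, is_test (K n)) /\ pointwise_consistent Theta0 Theta1 K) <->
  (exists Theta0_ Theta1_ : nat -> set (probability (borelType Omega) R),
     [/\ (forall i : nat, Theta0_ i `<=` Theta0_ i.+1),
         Theta0 = \bigcup_i Theta0_ i,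
         (forall i : nat, Theta1_ i `<=` Theta1_ i.+1),
         Theta1 = \bigcup_i Theta1_ i &
         forall i : nat, distinguishable (Theta0_ i) (Theta1_ i)]).
Proof.
split=> [[K [tK [alpha0 beta0]]]|].
  exists (fun i => [set P | Theta0 P /\
    forall n, (i < n)%N -> alpha_at (K n) P <= 4^-1]).
  exists (fun i => [set P | Theta1 P /\
    forall n, (i < n)%N -> beta_at (K n) P <= 4^-1]).
  split.
  - by move=> i P [? le_P]; split=> // n /ltnW; exact: le_P.
  - apply: (bigcup_eventually_le _ _ _ (fun n => alpha_at (K n))) => // n P.
    by have /andP[] := alpha_at01 n (K n) P (tK n).
  - by move=> i P [? le_P]; split=> // n /ltnW; exact: le_P.
  - apply: (bigcup_eventually_le _ _ _ (fun n => beta_at (K n))) => // n P.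
    exact: beta_at_ge0.
  - move=> i; apply: (distinguishable_quarter _ _ i (K i.+1)) => //.
    + by move=> P [_]; apply.
    + by move=> P [_]; apply.
case=> [A0 [A1 [nested0 -> nested1 -> /choice[K KP]]]].
have tK i n : is_test (K i n) by have [] := KP i.
(* The sum of the two uniform errors is used so that one choice of indices
   serves the hypothesis and the alternative. *)
have [iota [iotay err0]] : exists iota : nat -> nat,
    (iota n @[n --> \oo] --> \oo) /\
    (alpha (A0 (iota n)) (K (iota n) n) +
      beta (A1 (iota n)) (K (iota n) n) @[n --> \oo] --> (0 : R)).
  apply: (@diagonal_cvg0 R (fun i n =>
    alpha (A0 i) (K i n) + beta (A1 i) (K i n))) => i.
  by have [_ [a0 b0]] := KP i; rewrite -[0]addr0; exact: cvgD.
exists (fun n => K (iota n) n); split=> //; split=> P ThetaP.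
- apply: (squeeze_cvgr _ (cvg_cst 0) err0).
  apply: filterS (bigcup_nested_near _ _ _ _ nested0 ThetaP iotay) => n Pn.
  have /andP[-> _]/= := alpha_at01 n _ P (tK (iota n) n).
  apply: le_trans (alpha_at_le_alpha _ _ _ _ (tK (iota n) n) Pn) _.
  by rewrite lerDl beta_ge0.
- apply: (squeeze_cvgr _ (cvg_cst 0) err0).
  apply: filterS (bigcup_nested_near _ _ _ _ nested1 ThetaP iotay) => n Pn.
  rewrite beta_at_ge0//=.
  apply: le_trans (beta_at_le_beta _ _ _ _ (tK (iota n) n) Pn) _.
  by rewrite lerDr alpha_ge0.
Qed.
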